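(* Let $F(x)=\Delta^{-1}f(x)$ be a (tabulated) antidifference of a function $f(x)$ of a real variable. Then the antidifference $\sum_{s=1}^{\lfloor x\rfloor}f(x-s)$ of $f$ is related to $F$ by $$\sum_{s=1}^{\lfloor x\rfloor}f(x-s)=F(x)-F(\{x\}).$$
   Context: $\Delta$ is the forward difference operator, $\Delta F(x)=F(x+1)-F(x)$; $F$ is an antidifference of $f$, written $F=\Delta^{-1}f$, if $\Delta F(x)=f(x)$. $\lfloor x\rfloor$ is the usual floor function and $\{x\}=x-\lfloor x\rfloor$ is the fractional part of $x$. A sum whose upper limit is smaller than its lower limit equals $0$.
   Formalization: Both claims (the sum is an antidifference of f, and the identity) are stated for x ≥ 0 only; for x < 0 they fail with the empty-sum convention, e.g. f = 1, F(x) = x, x = −1 gives 0 versus −1. Correspondingly ΔF = f is assumed only for x ≥ 0. *)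

(* Defs.v *)
From mathcomp Require Import all_boot all_order all_algebra reals.

Set Implicit Arguments.
Unset Strict Implicit.
Unset Printing Implicit Defensive.

Import Order.TTheory GRing.Theory Num.Theory.
Local Open Scope ring_scope.

Definition forward_diff (R : realType) (F : R -> R) : R -> R :=
  fun x => F (x + 1) - F x.

(* D is needed because floor_sum f below, which vanishes on the negative reals,
   is an antidifference of f only on the nonnegative reals. *)
Definition antidifference_on (R : realType) (D : {pred R}) (F f : R -> R) :
  Prop := {in D, forward_diff F =1 f}.

Definition frac_part (R : realType) (x : R) : R := x - (Num.floor x)%:~R.

(* Sum of g s for s from 1 to n, with an integer upper limit n; it is 0 when
   n < 1 (the case n = Posz 0 is an empty big sum). *)
Definition sum_from1 (R : realType) (n : int) (g : nat -> R) : R :=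
  match n with
  | Posz m => \sum_(1 <= s < m.+1) g s
  | Negz _ => 0
  end.

Definition floor_sum (R : realType) (f : R -> R) : R -> R :=
  fun x => sum_from1 (Num.floor x) (fun s => f (x - s%:R)).

(* Main.v *)
Require Import Defs.
From mathcomp Require Import all_boot all_order all_algebra reals.

Set Implicit Arguments.
Unset Strict Implicit.
Unset Printing Implicit Defensive.

Import Order.TTheory GRing.Theory Num.Theory.
Local Open Scope ring_scope.

(** Each term [f (x - s)] is the increment of [F] from [x - s] to [x - s + 1], so the sum
    telescopes, leaving [F] at [x] and at [x] minus its floor ([floor_sum_telescope]). The
    subtracted [F (frac_part x)] has period 1 ([frac_partD1]), so differencing removes it, and
    [floor_sum f] inherits the antidifference property from [F]. *)

Lemma frac_partD1 (R : realType) (x : R) : frac_part (x + 1) = frac_part x.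
Proof.
by rewrite /frac_part floorDrz ?rpred1// floor1 intrD opprD addrACA subrr addr0.
Qed.

Lemma floor_sum_telescope (R : realType) (f F : R -> R) (x : R) :
  antidifference_on Num.nneg F f -> 0 <= x ->
  floor_sum f x = F x - F (frac_part x).
Proof.
move=> hF x_ge0; have := ge_floor x; have : 0 <= Num.floor x by rewrite floor_ge0.
rewrite /floor_sum /frac_part; case: (Num.floor x) => // n _ n_le_x /=.
(* The minus sign appears because the arguments [x - s] decrease as [s] grows. *)
transitivity (- \sum_(0 <= s < n) (F (x - s.+1%:R) - F (x - s%:R))).
  rewrite big_add1 -sumrN /=; apply: eq_big_nat => s /andP[_ s_lt_n].
  (* The point [x - s.+1] stays in the domain of [hF], since [s.+1 <= n <= x]. *)
  rewrite -hF; last by rewrite nnegrE subr_ge0 (le_trans _ n_le_x)// ler_nat.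
  by rewrite /forward_diff opprB -natr1 opprD addrA subrK.
by rewrite (telescope_sumr (fun s => F (x - s%:R)))// opprB subr0.
Qed.

Theorem theorem2p6 (R : realType) (f F : R -> R)
  (hF : antidifference_on Num.nneg F f) :
  antidifference_on Num.nneg (floor_sum f) f /\
  forall x : R, 0 <= x -> floor_sum f x = F x - F (frac_part x).
Proof.
have sumE x := @floor_sum_telescope R f F x hF.
split=> [x|]; last exact: sumE.
move=> x_ge0; rewrite -(hF x x_ge0) /forward_diff; rewrite nnegrE in x_ge0.
(* Both fractional parts agree, so the two copies of [F (frac_part x)] cancel. *)
by rewrite !sumE ?addr_ge0// frac_partD1 opprB addrA subrK.
Qed.
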